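(* Let $\epsilon>0$, and let $t\in\mathbb{R}$ and $\delta\in[0,\alpha]$ be such that $M:=\inf_{x\in X}M_x>0$, where $M_x=F(0;x)-F_\epsilon(-t;x)+(\alpha-\delta)$. Let $x\in X$ be such that $x\notin X_\alpha$. Then $$\mathbb{P}\left(F_\epsilon^N(-t;x)\ge 1-\delta\right)\le\exp\left\{-2NM_x^2\right\}.$$
   Context: Let $X\subseteq\mathbb{R}^n$ be closed, $\xi$ a random vector in $\mathbb{R}^s$ with distribution $\mathbb{P}_\xi$, $\alpha\in(0,1)$, $c:\mathbb{R}^n\times\mathbb{R}^s\to\mathbb{R}^m$, and $C(x,\xi)=\max_{j=1,\dots,m}c_j(x,\xi)$. Standing assumption: for each $x\in X$ the random variable $C(x,\xi)$ has a continuous distribution. Put $F(t;x)=\mathbb{P}(C(x,\xi)\le t)$ and $X_\alpha=\{x\in X\mid F(0;x)\ge 1-\alpha\}$. For $\epsilon>0$ let $\Gamma_\epsilon:\mathbb{R}\to[0,1]$ be given by $\Gamma_\epsilon(y)=1$ for $y\le-\epsilon$, $\Gamma_\epsilon(y)=\gamma_\epsilon(y)$ for $-\epsilon<y<\epsilon$, $\Gamma_\epsilon(y)=0$ for $y\ge\epsilon$, where $\gamma_\epsilon:[-\epsilon,\epsilon]\to[0,1]$ is strictly decreasing, symmetric (in the sense that $1-\gamma_\epsilon(y)=\gamma_\epsilon(-y)$), and such that $\Gamma_\epsilon$ is differentiable. Define $F_\epsilon(t;x)=\int_{\mathbb{R}^s}\Gamma_\epsilon(C(x,\xi)-t)\,d\mathbb{P}_\xi$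 and, for an i.i.d. sample $\xi_1,\dots,\xi_N$ of $\xi$, $F_\epsilon^N(t;x)=\frac1N\sum_{i=1}^N\Gamma_\epsilon(C(x,\xi_i)-t)$. The outer probability is with respect to the sample. *)

(* Defs.v *)
From HB Require Import structures.
From mathcomp Require Import all_boot all_order all_algebra.
From mathcomp Require Import all_classical all_reals all_analysis.

Set Implicit Arguments.
Unset Strict Implicit.
Unset Printing Implicit Defensive.

Import Order.TTheory GRing.Theory Num.Theory.
Import numFieldNormedType.Exports.

Local Open Scope classical_set_scope.
Local Open Scope ring_scope.

(* [s.-tuple R] stands for R^s with its product (Borel) sigma-algebra; the
   decision space R^n, of which only the topology is used, is ['rV[R]_n]. *)

(* The number of constraint functions is m + 1, so that the maximum is taken
   over a nonempty family. *)
Definition Cmax (R : realType) (n s m : nat)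
    (c : 'rV[R]_n -> s.-tuple R -> 'rV[R]_m.+1)
    (x : 'rV[R]_n) (z : s.-tuple R) : R :=
  \big[Num.max/c x z ord0 ord0]_(j < m.+1) c x z ord0 j.

(* Only the values of [gamma] on ]-eps, eps[ matter here. *)
Definition Gamma (R : realType) (eps : R) (gamma : R -> R) (y : R) : R :=
  if y <= - eps then 1 else if y < eps then gamma y else 0.

Record smoothing (R : realType) (eps : R) (gamma : R -> R) : Prop := {
  smoothing_itv : forall y, y \in `[- eps, eps] -> gamma y \in `[0, 1] ;
  smoothing_decr : forall y z, y \in `[- eps, eps] -> z \in `[- eps, eps] ->
    y < z -> gamma z < gamma y ;
  smoothing_sym : forall y, y \in `[- eps, eps] -> 1 - gamma y = gamma (- y) ;
  smoothing_derivable : forall y : R, derivable (Gamma eps gamma) y 1 }.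

Section Distribution_functions.
Context (R : realType) (n s m : nat).
Variable c : 'rV[R]_n -> s.-tuple R -> 'rV[R]_m.+1.
Context (d : measure_display) (Omega : measurableType d).
Variables (P : probability Omega R) (xi : {RV P >-> s.-tuple R}).

Definition Fdist (t : R) (x : 'rV[R]_n) : R :=
  fine (P [set w | Cmax c x (xi w) <= t]).

Definition feasible (X : set 'rV[R]_n) (alpha : R) : set 'rV[R]_n :=
  [set x | X x /\ 1 - alpha <= Fdist 0 x].

Definition Feps (eps : R) (gamma : R -> R) (t : R) (x : 'rV[R]_n) : R :=
  \int[distribution P xi]_z Gamma eps gamma (Cmax c x z - t).

Definition margin (eps : R) (gamma : R -> R) (alpha delta t : R)
    (x : 'rV[R]_n) : R :=
  Fdist 0 x - Feps eps gamma (- t) x + (alpha - delta).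

End Distribution_functions.

Definition FepsN (R : realType) (n s m N : nat)
    (c : 'rV[R]_n -> s.-tuple R -> 'rV[R]_m.+1)
    (eps : R) (gamma : R -> R) (zs : 'I_N -> s.-tuple R)
    (t : R) (x : 'rV[R]_n) : R :=
  N%:R^-1 * \sum_(i < N) Gamma eps gamma (Cmax c x (zs i) - t).

Definition mutually_independent (d d' : measure_display) (R : realType)
    (T : measurableType d) (T' : measurableType d') (P : probability T R)
    (I : finType) (X : I -> {RV P >-> T'}) : Prop :=
  forall (J : {set I}) (A : I -> set T'),
    (forall i, i \in J -> measurable (A i)) ->
    P (\bigcap_(i in [set` J]) (X i @^-1` A i)) =
    (\prod_(i in J) P (X i @^-1` A i))%E.

Definition iid_sample (d1 d2 d' : measure_display) (R : realType)
    (T1 : measurableType d1) (T2 : measurableType d2) (T' : measurableType d')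
    (P : probability T1 R) (Q : probability T2 R)
    (xi : {RV P >-> T'}) (N : nat) (xis : 'I_N -> {RV Q >-> T'}) : Prop :=
  mutually_independent xis /\
  forall (i : 'I_N) (A : set T'), measurable A ->
    distribution Q (xis i) A = distribution P xi A.

(* Main.v *)
(* The variables Gamma_eps (C(x, xi_i) + t) are i.i.d., take values in [0, 1]
   and have mean F_eps(-t; x).  Infeasibility means F(0; x) < 1 - alpha, hence
   F_eps(-t; x) + M_x < 1 - delta, so the event forces their empirical mean to
   exceed its expectation by at least M_x > 0, and Hoeffding's inequality
   applies.  The latter is obtained from Chernoff's bound at the parameter
   4 M_x. *)
Require Import Defs.
From HB Require Import structures.
From mathcomp Require Import all_boot all_order all_algebra.
From mathcomp Require Import all_classical all_reals all_analysis.
From mathcomp Require Import measurable_realfun.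
From mathcomp Require Import ring lra.

Set Implicit Arguments.
Unset Strict Implicit.
Unset Printing Implicit Defensive.

Import Order.TTheory GRing.Theory Num.Theory.
Import numFieldNormedType.Exports.

Local Open Scope classical_set_scope.
Local Open Scope ring_scope.

(** * Expectation of a product of independent nonnegative variables *)

Section independence.
Local Open Scope ereal_scope.
Import HBNNSimple.

(** Monotone convergence along the simple approximations [h n] of [f]. On the right [W] enters only
    through its integrals against indicators of events of [X], so one weight can be exchanged for
    another. *)
Lemma ge0_integralM_comp_lim d d' (T : measurableType d) (T' : measurableType d')
    (R : realType) (mu : {measure set T -> \bar R}) (X : {mfun T >-> T'})
    (W : T -> R) (f : T' -> \bar R) (mf : measurable_fun [set: T'] f) :
  measurable_fun [set: T] W -> (forall x, 0 <= W x)%R -> (forall y, 0 <= f y) ->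
  let h := nnsfun_approx measurableT mf in
  \int[mu]_x ((W x)%:E * f (X x)) =
  limn (fun n => \sum_(k \in range (h n))
    k%:E * \int[mu]_x (W x * \1_(h n @^-1` [set k]) (X x))%:E).
Proof.
move=> mW W0 f0 h.
have mEW : measurable_fun [set: T] (EFin \o W) by exact/measurable_EFinP.
transitivity (limn (fun n => \int[mu]_x ((W x)%:E * (h n (X x))%:E))).
  rewrite -monotone_convergence//.
  - apply: eq_integral => x _; apply/esym/cvg_lim => //.
    apply: cvgeZl => //; exact: cvg_nnsfun_approx.
  - move=> n; apply: emeasurable_funM => //.
    by apply/measurable_EFinP/measurableT_comp.
  - by move=> n x _; rewrite mule_ge0// lee_fin.
  - move=> x _ a b ab; rewrite lee_wpmul2l// lee_fin//.
    exact/lefP/nd_nnsfun_approx.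
congr (limn _); apply/funext => n.
have mI k : measurable_fun [set: T] (fun x => (\1_(h n @^-1` [set k]) (X x) : R)).
  have mIk : measurable_fun [set: T'] (\1_(h n @^-1` [set k]) : T' -> R) by [].
  exact: measurableT_comp mIk _.
have kI0 k x : 0 <= (k * \1_(h n @^-1` [set k]) (X x))%:E.
  exact: nnfun_muleindic_ge0.
transitivity (\int[mu]_x (\sum_(k \in range (h n))
    ((W x)%:E * (k * \1_(h n @^-1` [set k]) (X x))%:E))).
  apply: eq_integral => x _; rewrite fimfunE -fsumEFin//.
  by rewrite ge0_mule_fsumr.
rewrite ge0_integral_fsum//.
- apply: eq_fsbigr => k /[!inE] -[y _ <-].
  rewrite -ge0_integralZl//.
  + by apply: eq_integral => x _; rewrite !EFinM muleCA.
  + by apply/measurable_EFinP; exact: measurable_funM.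
  + by move=> x _; rewrite lee_fin mulr_ge0.
  + by rewrite lee_fin.
- move=> k; apply: emeasurable_funM => //.
  by apply/measurable_EFinP; exact: measurable_funM.
- by move=> k x _; rewrite mule_ge0// lee_fin.
Qed.

(** The limit formula gives the same expression for both sides. It serves to replace a weight by a
    constant. *)
Lemma eq_ge0_integralM_comp d d' (T : measurableType d) (T' : measurableType d')
    (R : realType) (mu : {measure set T -> \bar R}) (X : {mfun T >-> T'})
    (V W : T -> R) (f : T' -> \bar R) :
  measurable_fun [set: T] V -> measurable_fun [set: T] W ->
  (forall x, 0 <= V x)%R -> (forall x, 0 <= W x)%R ->
  (forall A, measurable A ->
    \int[mu]_x (V x * \1_A (X x))%:E = \int[mu]_x (W x * \1_A (X x))%:E) ->
  measurable_fun [set: T'] f -> (forall y, 0 <= f y) ->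
  \int[mu]_x ((V x)%:E * f (X x)) = \int[mu]_x ((W x)%:E * f (X x)).
Proof.
move=> mV mW V0 W0 VW mf f0; rewrite !(ge0_integralM_comp_lim _ _ mf)//.
congr (limn _); apply/funext => n; apply: eq_fsbigr => k _.
by rewrite VW.
Qed.

Lemma prod_indic (T : Type) (R : numDomainType) (I : finType)
    (J : {set I}) (A : I -> set T) (x : T) :
  (\prod_(i in J) \1_(A i) x = \1_(\bigcap_(i in [set` J]) A i) x :> R)%R.
Proof.
rewrite [RHS]indicE; have [xA|xA] := pselect (forall i, i \in J -> A i x).
  rewrite mem_set// big1// => i iJ; rewrite indicE mem_set//; exact: xA.
rewrite memNset//; move/existsNP : xA => [i /not_implyP[iJ Aix]].
by rewrite (bigD1 i)//= indicE memNset// mul0r.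
Qed.

(* Starting from indicators, for which this is the definition of independence,
   the [f i] are replaced by general functions one at a time; [s] lists the
   indices [i] for which [f i] need not be an indicator. *)
Lemma ge0_integral_prod_independent d d' (T : measurableType d)
    (T' : measurableType d') (R : realType) (P : probability T R)
    (I : finType) (X : I -> {RV P >-> T'}) (f : I -> T' -> R) :
  mutually_independent X ->
  (forall i, measurable_fun [set: T'] (f i)) -> (forall i y, 0 <= f i y)%R ->
  (forall i, \int[P]_w (f i (X i w))%:E < +oo) ->
  \int[P]_w (\prod_i f i (X i w))%R%:E = \prod_i \int[P]_w (f i (X i w))%:E.
Proof.
move=> indX.
have : forall i, i \notin enum I ->
  exists2 A, measurable A & f i = \1_A by move=> i; rewrite mem_enum.
elim: (enum I) f => [|j s IHs] f fs mf f0 foo.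
  have {}fs i : {A | measurable A /\ f i = \1_A}.
    by apply: cid; have [//|A] := fs i; exists A.
  pose A i := projT1 (fs i).
  have mA i : measurable (A i) by rewrite /A; case: (fs i) => ? [].
  have fA i : f i = \1_(A i) by rewrite /A; case: (fs i) => ? [].
  have mXA i : measurable (X i @^-1` A i) by exact: measurable_funPTI.
  transitivity (P (\bigcap_(i in [set` [set: I]%SET]) X i @^-1` A i)).
    rewrite -[X in P X]setIT -integral_indic//; last first.
      by apply: fin_bigcap_measurable => //; exact: finite_finset.
    apply: eq_integral => w _; congr (_%:E); rewrite -prod_indic.
    by apply: eq_big => [i|i _]; rewrite ?inE// fA.
  rewrite indX// (eq_bigl xpredT); last by move=> i; rewrite inE.
  apply: eq_bigr => i _; rewrite -[X in P X]setIT -integral_indic//.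
  by apply: eq_integral => w _; rewrite fA.
(* [g A] has an indicator at [j], so the induction hypothesis applies to it. [W] collects the other
   factors and [K] the product of their means. *)
pose g A i := if i == j then \1_A else f i.
pose W w := (\prod_(i | i != j) f i (X i w))%R.
pose K := (\prod_(i | i != j) \int[P]_w (f i (X i w))%:E).
have K0 : 0 <= K.
  by apply: prode_ge0 => i _; apply: integral_ge0 => w _; rewrite lee_fin.
have Kfin : K \is a fin_num.
  apply: prode_fin_num => i _; rewrite ge0_fin_numE//.
  by apply: integral_ge0 => w _; rewrite lee_fin.
rewrite [RHS](bigD1 j)//= -/K.
under eq_integral do rewrite (bigD1 j)//= mulrC -/(W _) EFinM.
(* [W] and the constant [K] have the same integral over every event of [X j], which is the induction
   hypothesis for [g A]; hence [W] may be replaced by [K] in front of [f j]. *)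
rewrite (@eq_ge0_integralM_comp _ _ _ _ _ _ (X j) W (cst (fine K)) (EFin \o f j))//=.
- rewrite ge0_integralZl//.
  + by rewrite fineK// muleC.
  + apply/measurable_EFinP; exact: measurableT_comp.
  + by move=> w _; rewrite lee_fin.
  + by rewrite lee_fin fine_ge0.
- rewrite /W; under eq_fun do rewrite big_mkcond.
  by apply: measurable_prod => i _; case: (i != j) => //; exact: measurableT_comp.
- by move=> w; apply: prodr_ge0.
- by move=> w; apply: fine_ge0.
- move=> A mA.
  have gE i : i != j -> g A i = f i by rewrite /g => /negbTE ->.
  have gjE : g A j = \1_A by rewrite /g eqxx.
  have mg i : measurable_fun [set: T'] (g A i) by rewrite /g; case: ifP.
  have g0 i y : (0 <= g A i y)%R by rewrite /g; case: ifP.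
  have AX : \int[P]_w (\1_A (X j w))%:E = P (X j @^-1` A).
    rewrite -[X in P X]setIT -integral_indic//; exact: measurable_funPTI.
  have /IHs : forall i, i \notin s -> exists2 B, measurable B & g A i = \1_B.
    move=> i si; have [->|ij] := eqVneq i j; first by exists A.
    by rewrite gE//; apply: fs; rewrite inE negb_or ij.
  move=> /(_ mg g0) IHg.
  transitivity (\int[P]_w (\prod_i g A i (X i w))%R%:E).
    apply: eq_integral => w _; rewrite (bigD1 j)//= gjE mulrC.
    by congr (_ * _)%:E; apply: eq_bigr => i /gE ->.
  rewrite IHg => [|i].
    rewrite (bigD1 j)//= gjE (eq_bigr (fun i => \int[P]_w (f i (X i w))%:E)).
      rewrite -/K muleC -{1}(fineK Kfin) -ge0_integralZl//.
      + apply/measurable_EFinP.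
        have mIA : measurable_fun [set: T'] (\1_A : T' -> R) by [].
        exact: measurableT_comp mIA _.
      + by rewrite lee_fin fine_ge0.
    by move=> i /gE ->.
  (* The means of [g A] must be finite; at [j] the mean is a probability. *)
  have [->|ij] := eqVneq i j; last by rewrite gE.
  rewrite gjE AX (le_lt_trans (probability_le1 _ _))// ?ltry//.
  exact: measurable_funPTI.
- exact/measurable_EFinP.
- by move=> y; rewrite lee_fin.
Qed.

End independence.

(** * Exponential moments of variables with values in the unit interval *)

(** Two-point case of Hoeffding's lemma, to which convexity reduces the general one. The logarithm
    of the left side has value 0 and slope [p] at 0, and its second derivative, the variance of a
    two-point variable, is at most 1/4; this is the source of the constant 8. *)
Lemma bernoulli_mgf_le (R : realType) (p r : R) : 0 <= p <= 1 -> 0 <= r ->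
  1 - p + p * expR r <= expR (p * r + r ^+ 2 / 8).
Proof.
move=> /andP[p0 p1] r0.
(* The quotient [g] of the two sides is nonincreasing: its derivative has the
   sign of [- q], and [q] is nondecreasing from [q 0 = 0] because
   [4 a b <= (a + b) ^+ 2] with [a + b = D x]. *)
pose D x : R := 1 - p + p * expR x.
have D0 x : 0 < D x.
  rewrite /D; have [->|p_gt0] := eqVneq p 0; first by rewrite mul0r subr0 addr0.
  by rewrite ltr_wpDl ?subr_ge0// mulr_gt0 ?expR_gt0// lt_def p_gt0.
have dD (x : R) : is_derive x (1 : R) D (p * expR x).
  rewrite /D; apply: is_derive_eq; rewrite /GRing.scale/=; lra.
pose q x : R := p + x / 4 - p * expR x / D x.
have dq (x : R) : is_derive x (1 : R) q (4^-1 - p * expR x * (1 - p) / D x ^+ 2).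
  rewrite /q; have Dx : D x != 0 by rewrite gt_eqF.
  have := is_deriveV Dx (dD x) => dV.
  apply: is_derive_eq.
  rewrite /GRing.scale/= /D.
  field.
  exact: Dx.
have q0 x : 0 <= x -> 0 <= q x.
  move=> x0; have q00 : q 0 = 0 by rewrite /q /D expR0 mulr1 subrK; field.
  rewrite -q00; apply: (@ger0_derive1_ndecry _ q 0) => //.
  - move=> y _; rewrite derive1E; case: (dq y) => _ ->.
    rewrite subr_ge0 ler_pdivrMr ?exprn_gt0// /D.
    have := sqr_ge0 (1 - p - p * expR y); lra.
  - by apply: derivable_within_continuous => y _; case: (dq y).
pose g x : R := D x * expR (- (p * x + x ^+ 2 / 8)).
have dg (x : R) : is_derive x (1 : R) g (- (D x * q x) * expR (- (p * x + x ^+ 2 / 8))).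
  rewrite /g; have Dx : D x != 0 by rewrite gt_eqF.
  apply: is_derive_eq.
  rewrite /GRing.scale/= /q.
  by field; rewrite Dx.
have : g r <= g 0.
  apply: (@ler0_derive1_nincry _ g 0) => //.
  - move=> y; rewrite in_itv/= andbT => y0; rewrite derive1E; case: (dg y) => _ ->.
    by rewrite mulNr oppr_le0 !mulr_ge0 ?expR_ge0 ?q0// ltW.
  - by apply: derivable_within_continuous => y _; case: (dg y).
rewrite /g {2}/D mulr0 expr0n/= mul0r addr0 oppr0 expR0 !mulr1 subrK.
by rewrite expRN ler_pdivrMr ?expR_gt0// mul1r.
Qed.

(** Convexity of the exponential between 0 and [r], with weight [y] at [r]. The bound is affine in
    [y], so its expectation depends only on the mean. *)
Lemma expR_le_chord (R : realType) (r y : R) : 0 <= y <= 1 ->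
  expR (r * y) <= 1 + (expR r - 1) * y.
Proof.
move=> /andP[y0 y1].
have := convex_expR (Itv01 y0 y1) (r : R^o) (0 : R^o).
rewrite !convRE/= expR0 mulr0 addr0 mulrC => /le_trans; apply.
by rewrite /unstable.onem; lra.
Qed.

(** * Hoeffding's inequality *)

Section hoeffding.
Local Open Scope ereal_scope.

(** Integrating the chord bound yields [1 - p + p * expR r], the Bernoulli case. *)
Lemma ge0_integral_expR_le d (T : measurableType d) (R : realType)
    (P : probability T R) (Y : {RV P >-> R}) (p r : R) :
  (forall w, 0 <= Y w <= 1)%R -> \int[P]_w (Y w)%:E = p%:E -> (0 <= r)%R ->
  \int[P]_w (expR (r * Y w))%:E <= (expR (p * r + r ^+ 2 / 8))%:E.
Proof.
move=> Y01 Yp r0.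
have Y0 w : (0 <= Y w)%R by case/andP: (Y01 w).
have mY : measurable_fun [set: T] (EFin \o Y) by exact/measurable_EFinP.
have er0 : (0 <= expR r - 1)%R by rewrite subr_ge0 -expR0 ler_expR.
have int1 : \int[P]_w (cst 1 w) = 1.
  by rewrite integral_cst//= probability_setT mule1.
have p01 : (0 <= p <= 1)%R.
  apply/andP; split; rewrite -lee_fin -Yp.
    by apply: integral_ge0 => w _; rewrite lee_fin.
  rewrite -int1; apply: ge0_le_integral => //.
  - by move=> w _; rewrite lee_fin.
  - by move=> w _; rewrite lee_fin; have /andP[] := Y01 w.
apply: (@le_trans _ _ (\int[P]_w (cst 1 w + (expR r - 1)%:E * (Y w)%:E))).
  apply: ge0_le_integral => //.
  - apply/measurable_EFinP; apply: measurableT_comp => //.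
    exact: measurable_funM.
  - apply: emeasurable_funD => //; exact: emeasurable_funM.
  - by move=> w _; rewrite -EFinM -EFinD lee_fin expR_le_chord.
rewrite ge0_integralD//; last 2 first.
- by move=> w _; rewrite mule_ge0 ?lee_fin.
- exact: emeasurable_funM.
rewrite int1 ge0_integralZl//; last by move=> w _; rewrite lee_fin.
rewrite Yp -EFinM -EFinD lee_fin.
by apply: le_trans (bernoulli_mgf_le p01 r0); lra.
Qed.

(** By independence the exponential moment of the sum is the product of those of its terms, and
    Chernoff's bound turns it into a tail estimate. *)
Lemma hoeffding d d' (T : measurableType d) (T' : measurableType d')
    (R : realType) (P : probability T R) (I : finType) (X : I -> {RV P >-> T'})
    (f : I -> T' -> R) (p : I -> R) (u : R) :
  mutually_independent X ->
  (forall i, measurable_fun [set: T'] (f i)) ->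
  (forall i y, 0 <= f i y <= 1)%R ->
  (forall i, \int[P]_w (f i (X i w))%:E = (p i)%:E) -> (0 < u)%R ->
  P [set w | (\sum_i p i + #|I|%:R * u <= \sum_i f i (X i w))%R]
    <= (expR (- 2 * #|I|%:R * u ^+ 2))%:E.
Proof.
move=> indX mf f01 fp u0.
pose Y i w := f i (X i w).
have mY i : measurable_fun [set: T] (Y i) by exact: measurableT_comp.
pose S w := (\sum_i Y i w)%R.
have mS : measurable_fun [set: T] S by exact: measurable_sum.
pose YRV i : {RV P >-> R} := HB.pack (Y i) (isMeasurableFun.Build _ _ _ _ _ (mY i)).
pose SRV : {RV P >-> R} := HB.pack S (isMeasurableFun.Build _ _ _ _ _ mS).
(* The final exponent is [#|I| * (r ^+ 2 / 8 - r * u)]; it is least at [r = 4 * u], with value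
   [- 2 * #|I| * u ^+ 2]. *)
pose r := (4 * u)%R.
have r0 : (0 < r)%R by rewrite mulr_gt0.
have mgfY i : \int[P]_w (expR (r * Y i w))%:E <= (expR (p i * r + r ^+ 2 / 8))%:E.
  by apply: (@ge0_integral_expR_le _ _ _ _ (YRV i));
    [move=> w; exact: f01|exact: fp|exact: ltW].
have mgfY0 i : 0 <= \int[P]_w (expR (r * Y i w))%:E.
  by apply: integral_ge0 => w _; rewrite lee_fin expR_ge0.
have mgfYfin i : \int[P]_w (expR (r * Y i w))%:E \is a fin_num.
  by rewrite ge0_fin_numE// (le_lt_trans (mgfY i))// ltry.
have mgfS : 'M_P SRV r <= (expR (r * \sum_i p i + #|I|%:R * (r ^+ 2 / 8)))%:E.
  rewrite /mmt_gen_fun unlock.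
  under eq_integral do rewrite /= mulrC mulr_sumr expR_sum.
  rewrite (@ge0_integral_prod_independent _ _ _ _ _ _ _ _
    (fun i y => expR (r * f i y)))//.
  - under eq_bigr do rewrite -(fineK (mgfYfin _)).
    rewrite prodEFin lee_fin mulr_sumr.
    rewrite -sumr_const mulr_suml -big_split/= expR_sum.
    apply: ler_prod => i _; rewrite fine_ge0//=.
    rewrite -lee_fin fineK// mul1r [(r * _)%R]mulrC; exact: mgfY.
  - move=> i; apply: measurableT_comp => //; exact: measurable_funM.
  - by move=> i; rewrite (le_lt_trans (mgfY i))// ltry.
apply: (le_trans (chernoff SRV _ r0)).
apply: (@le_trans _ _ ((expR (r * \sum_i p i + #|I|%:R * (r ^+ 2 / 8)))%:E *
    (expR (- (r * (\sum_i p i + #|I|%:R * u))))%:E)).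
  by rewrite lee_wpmul2r// lee_fin expR_ge0.
by rewrite -EFinM -expRD lee_fin ler_expR /r; lra.
Qed.

End hoeffding.

(** * Application to the smoothed empirical distribution function *)

Lemma Gamma_itv01 (R : realType) (eps : R) (gamma : R -> R) (y : R) :
  smoothing eps gamma -> 0 <= Gamma eps gamma y <= 1.
Proof.
move=> gammaP; rewrite /Gamma; case: (leP y) => [_|ey]; first by rewrite ler01 lexx.
case: ltP => [ye|_]; last by rewrite lexx ler01.
have y_itv : y \in `[- eps, eps] by rewrite in_itv/= !ltW.
by have := smoothing_itv gammaP y_itv; rewrite in_itv.
Qed.

Lemma measurable_Gamma (R : realType) (eps : R) (gamma : R -> R) :
  smoothing eps gamma -> measurable_fun [set: R] (Gamma eps gamma).
Proof.
move=> gammaP; apply: continuous_measurable_fun => y.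
exact/differentiable_continuous/derivable1_diffP/(smoothing_derivable gammaP).
Qed.

Lemma measurable_superlevel d (T : measurableType d) (R : realType)
    (S : T -> R) (a : R) :
  measurable_fun [set: T] S -> measurable [set w | a <= S w].
Proof.
move=> mS; rewrite (_ : [set _ | _] = S @^-1` `[a, +oo[).
  by rewrite -[X in measurable X]setTI; exact: mS.
by apply/seteqP; split => w /=; rewrite in_itv/= andbT.
Qed.

Theorem theorem3p8 (R : realType) (n s m : nat)
    (X : set 'rV[R]_n) (closedX : closed X)
    (c : 'rV[R]_n -> s.-tuple R -> 'rV[R]_m.+1)
    (measurable_C : forall x, X x -> measurable_fun [set: s.-tuple R] (Cmax c x))
    (d : measure_display) (Omega : measurableType d) (P : probability Omega R)
    (xi : {RV P >-> s.-tuple R})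
    (continuous_C : forall x, X x -> continuous (fun t : R => Fdist c xi t x))
    (alpha : R) (alpha_gt0 : 0 < alpha) (alpha_lt1 : alpha < 1)
    (eps : R) (eps_gt0 : 0 < eps)
    (gamma : R -> R) (gammaP : smoothing eps gamma)
    (d' : measure_display) (Omega' : measurableType d')
    (Q : probability Omega' R) (N : nat) (N_gt0 : (0 < N)%N)
    (xis : 'I_N -> {RV Q >-> s.-tuple R}) (iid_xis : iid_sample xi xis)
    (t delta : R) (delta_ge0 : 0 <= delta) (delta_le : delta <= alpha)
    (M_gt0 : 0 < inf [set margin c xi eps gamma alpha delta t y | y in X])
    (x : 'rV[R]_n) (Xx : X x) (xNfeasible : ~ feasible c xi X alpha x) :
  (Q [set w | (1 - delta <= FepsN c eps gamma (fun i => xis i w) (- t) x)%R]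
   <= (expR (- 2 * N%:R * margin c xi eps gamma alpha delta t x ^+ 2))%:E)%E.
Proof.
have [indxi distxi] := iid_xis.
set u := margin c xi eps gamma alpha delta t x.
(* [inf] is 0 on a set that is not bounded below, so [M_gt0] forces a lower
   bound. *)
have u_gt0 : 0 < u.
  apply: (lt_le_trans M_gt0); apply: ge_inf; last by exists x.
  apply: contrapT => Nlb; move: M_gt0; rewrite inf_out ?ltxx// => -[_ lb].
  exact: Nlb.
have F0_lt : Fdist c xi 0 x < 1 - alpha.
  by rewrite ltNge; apply/negP => F0_ge; exact: xNfeasible.
(* The double negation is kept so that [f] is convertible to the integrand of [Feps] and the summand
   of [FepsN] at [- t]. *)
pose f z := Gamma eps gamma (Cmax c x z - - t).
have f01 z : 0 <= f z <= 1 by exact: Gamma_itv01.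
have f0 z : 0 <= f z by case/andP: (f01 z).
have mf : measurable_fun [set: s.-tuple R] f.
  apply: measurableT_comp; first exact: measurable_Gamma.
  by apply: measurable_funB => //; exact: measurable_C.
have mEf : measurable_fun [set: s.-tuple R] (EFin \o f) by exact/measurable_EFinP.
set p := Feps c xi eps gamma (- t) x.
have fp i : (\int[Q]_w (f (xis i w))%:E = p%:E)%E.
  transitivity (\int[distribution Q (xis i)]_z (f z)%:E)%E.
    by rewrite ge0_integral_distribution// => z; rewrite lee_fin.
  transitivity (\int[distribution P xi]_z (f z)%:E)%E.
    by apply: eq_measure_integral => A mA _; exact: distxi.
  (* A real-valued integral is [fine] of the extended one, and [fine] sends infinities to 0, so
     finiteness has to be checked; it follows from [f <= 1]. *)
  rewrite (_ : p = fine (\int[distribution P xi]_z (f z)%:E)%E)//.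
  rewrite fineK// ge0_fin_numE; last first.
    by apply: integral_ge0 => z _; rewrite lee_fin.
  apply: (@le_lt_trans _ _ (\int[distribution P xi]_z (cst 1 z))%E).
    apply: ge0_le_integral => //.
    - by move=> z _; rewrite lee_fin.
    - by move=> z _; rewrite lee_fin; have /andP[] := f01 z.
  by rewrite integral_cst//= probability_setT mule1 ltry.
have mS : measurable_fun [set: Omega'] (fun w => \sum_i f (xis i w)).
  by apply: measurable_sum => i; exact: measurableT_comp.
have := hoeffding indxi (fun=> mf) (fun=> f01) fp u_gt0.
rewrite card_ord; apply: le_trans; apply: le_measure; rewrite ?inE.
- apply: measurable_superlevel; rewrite /FepsN; exact: measurable_funM.
- exact: measurable_superlevel.
move=> w /=; rewrite /FepsN => le_mean.
rewrite sumr_const card_ord -[p *+ N]mulr_natl -mulrDr.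
rewrite -ler_pdivlMl ?ltr0n//; apply: le_trans le_mean.
(* In [p + u] the two occurrences of [p] cancel; what remains is below [1 - delta] by [F0_lt]. *)
by rewrite /u /margin -/p; lra.
Qed.
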